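(* Let $1/2 < t < 1$. Then there exists a natural number $N$ (depending only on $t$) such that for every natural number $n_0 \geq N$, the squares of sidelength $n^{-t}$ for $n \geq n_0$ (one square for each natural number $n \ge n_0$) can perfectly pack a square of area $\sum_{n=n_0}^\infty \frac{1}{n^{2t}}$.
   Context: All rectangles and squares are subsets of $\mathbb{R}^2$ with sides parallel to the coordinate axes, and are topologically closed. A packing by rectangles of a region $\Omega \subset \mathbb{R}^2$ is a finite or countably infinite family of rectangles contained in $\Omega$ with (pairwise) disjoint interiors. A packing is perfect if the rectangles cover $\Omega$ up to Lebesgue null sets. Saying that a list of squares of prescribed sidelengths ''can perfectly pack'' $\Omega$ means that there is a perfect packing of $\Omega$ by a family consisting of exactly one square of each prescribed sidelength in the list. *)

(* Defs.v *)
From HB Require Import structures.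
From mathcomp Require Import all_boot all_order all_algebra.
From mathcomp Require Import all_classical all_reals all_analysis.

Set Implicit Arguments.
Unset Strict Implicit.
Unset Printing Implicit Defensive.

Import Order.TTheory GRing.Theory Num.Theory.
Import numFieldNormedType.Exports.

Local Open Scope classical_set_scope.
Local Open Scope ring_scope.

Definition lebesgue2 (R : realType) : set (R * R) -> \bar R :=
  ((@lebesgue_measure R) \x (@lebesgue_measure R))%E.

Definition is_rectangle (R : realType) (A : set (R * R)) : Prop :=
  exists a b c d : R, [/\ a < b, c < d & A = `[a, b] `*` `[c, d]].

Definition is_square (R : realType) (s : R) (A : set (R * R)) : Prop :=
  0 < s /\ exists a b : R, A = `[a, a + s] `*` `[b, b + s].

(* The family is indexed by the elements of [D]; indices outside of [D] are
   ignored. [A°] is the interior for the product topology on [R * R]. *)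
Definition is_packing (R : realType) (I : Type) (D : set I)
    (F : I -> set (R * R)) (Omega : set (R * R)) : Prop :=
  [/\ countable D,
      (forall i, D i -> is_rectangle (F i)),
      (forall i, D i -> F i `<=` Omega) &
      trivIset D (fun i => (F i)°)].

Definition is_perfect_packing (R : realType) (I : Type) (D : set I)
    (F : I -> set (R * R)) (Omega : set (R * R)) : Prop :=
  is_packing D F Omega /\
  (@lebesgue2 R).-negligible (Omega `\` \bigcup_(i in D) F i).

(* The list of prescribed sidelengths is [s i] for [i] in [D], with
   multiplicity: there is one square for each index. *)
Definition can_perfectly_pack (R : realType) (I : Type) (D : set I)
    (s : I -> R) (Omega : set (R * R)) : Prop :=
  exists Q : I -> set (R * R),
    (forall i, D i -> is_square (s i) (Q i)) /\ is_perfect_packing D Q Omega.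

(* Main.v *)
Require Import Defs.
From HB Require Import structures.
From mathcomp Require Import all_boot all_order all_algebra.
From mathcomp Require Import all_classical all_reals all_analysis.
From mathcomp Require Import ring lra zify.
Import Order.TTheory GRing.Theory Num.Theory.
Import numFieldNormedType.Exports.
Local Open Scope classical_set_scope.
Local Open Scope ring_scope.

(** The squares are placed greedily, row by row, and the unused part of the big
    square is kept as a finite list of boxes. With d = 1 - t, such a list is
    measured by the sum of its weighted perimeters w^d h + w h^d ([wperim]).

    Two facts make the greedy algorithm run forever. First, the unused area is
    the total area of the squares still to be placed, which exceeds n^(1-2t)
    when n^-t is the next side. If the weighted perimeter is at most
    M^-t n^(d^2), comparing the two sums yields a box whose two sides are both
    larger than M n^-t ([fat_box_exists], [wperim_fat]). Secondly, one row of
    the squares n^-t, (n+1)^-t, ... is cut along such a box, as long as possible.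
    Its m >= M squares leave a gap above each square and a gap at the end of the
    row. The gap at the end costs at most 2 n^(-t(1+d)), that is at most
    (2/M) n^(-t(1+d)) per square. The squares of the row are nearly equal: the
    gaps above them have height at most n^-t (m/n), and m/n = O(n^-d) because the
    row has length at most 1, so that the weight d > 0 makes these gaps cheap.
    Meanwhile n^(d^2) grows by a multiple of n^(-t(1+d)) for each placed square.
    Since M^d is large, M^-t times this growth pays for both kinds of gaps
    ([row_cost]), and the bound on the weighted perimeter persists ([row_step]).

    The squares placed in this way stay where they are ([growing_seq_limit]),
    have disjoint interiors, and their areas add up to the area of the big
    square, hence they miss only a null set ([perfect_packing_of_boxes]). *)

Set Implicit Arguments.
Unset Strict Implicit.
Unset Printing Implicit Defensive.

(** * Dissections of a box *)

(** A box is encoded by its lower left corner, its width and its height, so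
    that cutting it only involves linear arithmetic. *)
Definition box (R : realFieldType) : Type := (R * R * R * R)%type.

Section Dissections.
Variable R : realFieldType.
Implicit Types (a b x y w h s : R) (B C D E : box R) (F G S : seq (box R)).

Definition bleft B := B.1.1.1.
Definition bbottom B := B.1.1.2.
Definition bwidth B := B.1.2.
Definition bheight B := B.2.
Definition area B := bwidth B * bheight B.

Definition encloses B C : bool :=
  [&& 0 <= bwidth C, 0 <= bheight C, bleft B <= bleft C,
      bleft C + bwidth C <= bleft B + bwidth B, bbottom B <= bbottom C
    & bbottom C + bheight C <= bbottom B + bheight B].

(** The boxes lie on the two sides of some horizontal or vertical line: this
    implies that their interiors are disjoint, but it is arithmetical. *)
Definition apart B C : bool :=
  [|| bleft B + bwidth B <= bleft C, bleft C + bwidth C <= bleft B,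
      bbottom B + bheight B <= bbottom C
    | bbottom C + bheight C <= bbottom B].

Definition dissects B F : Prop :=
  [/\ all (encloses B) F, pairwise apart F & \sum_(C <- F) area C = area B].

Lemma apartC : symmetric apart.
Proof.
move=> B C; rewrite /apart !orbA.
by rewrite [(_ <= bleft C) || _]orbC -!orbA [(_ <= bbottom C) || _]orbC.
Qed.

Lemma apart_encloses B B' C :
  encloses B C -> apart B' B -> apart B' C.
Proof.
case/and5P => w0 h0 l1 l2 /andP[l3 l4].
by case/or4P => ?; apply/or4P;
  [apply: Or41|apply: Or42|apply: Or43|apply: Or44]; lra.
Qed.

Lemma encloses_trans B C D : encloses C D -> encloses B C -> encloses B D.
Proof.
by move=> /and5P[? ? ? ? /andP[? ?]] /and5P[? ? ? ? /andP[? ?]];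
  apply/and5P; split; [..|apply/andP; split]; lra.
Qed.

Lemma dissects_perm B F G : perm_eq F G -> dissects B F -> dissects B G.
Proof.
move=> pFG [inF sF aF]; split; first by rewrite -(perm_all _ pFG).
- apply: (catCA_perm_ind (P := pairwise apart) _ pFG sF) => s1 s2 s3.
  rewrite !pairwise_cat !allrel_catr [allrel _ s2 s1]allrelC.
  rewrite (@eq_allrel _ _ _ apart) => [|C D]; last by rewrite apartC.
  by case/and3P => /andP[-> ->] -> /and3P[-> -> ->].
- by rewrite -(perm_big _ pFG).
Qed.

(** Cutting is only ever done on one piece of a dissection; the disjointness from
    the other pieces is inherited from the piece that is cut. *)
Lemma dissects_refine B C F G :
  dissects B (C :: F) -> dissects C G -> dissects B (G ++ F).
Proof.
move=> [/= /andP[inC inF] /andP[sC sF] aF] [inG sG aG]; split.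
- rewrite all_cat inF andbT; apply: sub_all inG => D inD.
  exact: encloses_trans inD inC.
- rewrite pairwise_cat sF sG !andbT allrelC.
  apply/allrelP => D E DF EG /=.
  rewrite apartC; apply: apart_encloses (allP inG _ EG) _.
  by rewrite apartC (allP sC).
- by rewrite big_cat /= aG -aF big_cons.
Qed.

Lemma dissects_self B : 0 <= bwidth B -> 0 <= bheight B -> dissects B [:: B].
Proof.
by move=> w0 h0; split; rewrite /= ?big_seq1 // /encloses w0 h0 !lexx.
Qed.

Lemma dissects_vcut x y w h a : 0 <= a <= w -> 0 <= h ->
  dissects (x, y, w, h) [:: (x, y, a, h); (x + a, y, w - a, h)].
Proof.
move=> /andP[a0 aw] h0; split.
- by rewrite /= /encloses /bwidth /bheight /bleft /bbottom /=;
  apply/andP; split; [|apply/andP; split => //];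
  apply/and5P; split; [..|apply/andP; split| | | | |apply/andP; split]; lra.
- by rewrite /= /apart /bwidth /bheight /bleft /bbottom /= lexx.
- by rewrite !big_cons big_nil /area /bwidth /bheight /=; ring.
Qed.

Lemma dissects_hcut x y w h a : 0 <= w -> 0 <= a <= h ->
  dissects (x, y, w, h) [:: (x, y, w, a); (x, y + a, w, h - a)].
Proof.
move=> w0 /andP[a0 ah]; split.
- by rewrite /= /encloses /bwidth /bheight /bleft /bbottom /=;
  apply/andP; split; [|apply/andP; split => //];
  apply/and5P; split; [..|apply/andP; split| | | | |apply/andP; split]; lra.
- by rewrite /= /apart /bwidth /bheight /bleft /bbottom /= lexx !orbT.
- by rewrite !big_cons big_nil /area /bwidth /bheight /=; ring.
Qed.

Definition dims B : R * R := (bwidth B, bheight B).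

(** The row is cut by vertical lines into pieces of widths [ss]; the square is
    then at the bottom of each piece, and a gap remains above it. *)
Lemma dissects_row x y w s (ss : seq R) :
    0 <= s -> all (fun a => 0 <= a <= s) ss -> \sum_(a <- ss) a <= w ->
  exists S G, [/\ dissects (x, y, w, s) (S ++ G),
    map dims S = [seq (a, a) | a <- ss] &
    map dims G = (w - \sum_(a <- ss) a, s) :: [seq (a, s - a) | a <- ss]].
Proof.
move=> s0; elim: ss x w => [|a ss IH] x w /=.
  rewrite big_nil => _ w0; exists [::], [:: (x, y, w, s)].
  by rewrite subr0; split => //; exact: dissects_self.
rewrite big_cons => /andP[/andP[a0 as_] ss0] aw.
have sum0 : 0 <= \sum_(b <- ss) b.
  rewrite big_seq sumr_ge0 // => b bss.
  by have /allP/(_ b bss)/andP[] := ss0.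
have [|S [G [dSG dimS dimG]]] := IH (x + a) (w - a) ss0; first lra.
have aw' : 0 <= a <= w by lra.
have aS' : 0 <= a <= s by rewrite a0.
have dc := dissects_refine (dissects_vcut x y aw' s0) (dissects_hcut x y a0 aS').
rewrite [_ ++ _]/= in dc.
have pm : perm_eq [:: (x, y, a, a); (x, y + a, a, s - a); (x + a, y, w - a, s)]
   [:: (x + a, y, w - a, s); (x, y, a, a); (x, y + a, a, s - a)].
  by apply/permP => p /=; ring.
have := dissects_refine (dissects_perm pm dc) dSG.
case: G dSG dimG => [//|g G] dSG [wg hg dimG] dall.
exists ((x, y, a, a) :: S), (g :: (x, y + a, a, s - a) :: G); split.
- apply: dissects_perm dall; apply/permP => p.
  by rewrite !count_cat /=; ring.
- by rewrite /= dimS.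
- by rewrite /= dimG /dims wg hg opprD addrA.
Qed.

End Dissections.

(** * Estimates on real powers *)

Section PowerEstimates.
Variable R : realType.
Implicit Types (a x y q : R).

(** This is the inequality [1 + z <= expR z] at z = a ln (y / x); combined with
    the concavity of [ln] it gives the two bounds that follow, and these in turn
    give the bounds on sums of powers. *)
Lemma powR_ge_ln a x y : 0 < x -> 0 < y ->
  x `^ a * (1 + a * ln (y / x)) <= y `^ a.
Proof.
move=> x0 y0; have yx0 : 0 < y / x by rewrite divr_gt0.
rewrite -[y in leRHS](divfK (lt0r_neq0 x0)) powRM ?(ltW yx0) ?(ltW x0) // mulrC.
rewrite ler_wpM2r ?powR_ge0 // [leRHS]/powR gt_eqF //; exact: expR_ge1Dx.
Qed.

Lemma ln_le_subr1 x : 0 < x -> ln x <= x - 1.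
Proof. by move=> x0; rewrite -{1}(subrKC 1 x) le_ln1Dx // ltrBrDr addNr. Qed.

Lemma powR_ge_tangent_neg a x y : a <= 0 -> 0 < x -> 0 < y ->
  x `^ a * (1 + a * (y / x - 1)) <= y `^ a.
Proof.
move=> a0 x0 y0; apply: le_trans (powR_ge_ln a x0 y0).
rewrite ler_wpM2l ?powR_ge0 // lerD2l ler_wnM2l //.
by rewrite ln_le_subr1 // divr_gt0.
Qed.

Lemma powR_ge_growth a x y : 0 <= a -> 0 < x -> 0 < y ->
  x `^ a * (1 + a * (1 - x / y)) <= y `^ a.
Proof.
move=> a0 x0 y0; apply: le_trans (powR_ge_ln a x0 y0).
rewrite ler_wpM2l ?powR_ge0 // lerD2l ler_wpM2l //.
have xy0 : 0 < x / y by rewrite divr_gt0.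
have := ln_le_subr1 xy0.
by rewrite -[y / x]invf_div lnV ?posrE //; lra.
Qed.

Lemma powR_nat_unbounded a C : 0 < a ->
  exists n0 : nat, forall n, (n0 <= n)%N -> C <= n%:R `^ a :> R.
Proof.
move=> a0; pose c := Num.max C 0.
have c0 : 0 <= c by rewrite le_max lexx orbT.
exists (Num.bound (c `^ a^-1)) => n n0n.
have le_cn : c `^ a^-1 <= n%:R :> R.
  apply: ltW; apply: lt_le_trans (archi_boundP (powR_ge0 _ _)) _.
  by rewrite ler_nat.
apply: (@le_trans _ _ c); first by rewrite le_max lexx.
have -> : c = (c `^ a^-1) `^ a by rewrite -powRrM mulVf ?gt_eqF // powRr1.
by apply: ge0_ler_powR; rewrite ?nnegrE ?powR_ge0 ?ler0n ?(ltW a0).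
Qed.

(** The sum telescopes: by convexity each increment of j^-q is bounded by the
    derivative at j, and likewise on the other side for [sum_powR_le]. *)
Lemma sum_powR_ge q n K : 0 < q -> (0 < n)%N -> (n <= K)%N ->
  n%:R `^ (- q) - K%:R `^ (- q) <=
    q * \sum_(n <= j < K) j%:R `^ (- (1 + q)) :> R.
Proof.
move=> q0 n0 nK; rewrite big_distrr /= -opprB.
rewrite -(telescope_sumr (fun j => j%:R `^ (- q) : R)) // -sumrN.
rewrite !big_nat; apply: ler_sum => j /andP[nj _].
have j0 : 0 < j%:R :> R by rewrite ltr0n (leq_trans n0).
have := @powR_ge_tangent_neg (- q) j%:R j.+1%:R.
rewrite oppr_le0 (ltW q0) j0 ltr0n => /(_ isT isT isT).
have -> : j%:R `^ (- (1 + q)) = j%:R `^ (- q) / j%:R :> R.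
  rewrite opprD addrC powRD; last by rewrite (gt_eqF j0) implybT.
  by rewrite powR_inv1 // ltW.
have -> : j.+1%:R / j%:R - 1 = j%:R^-1 :> R.
  by rewrite -natr1 mulrDl divff ?gt_eqF // mul1r addrAC subrr add0r.
rewrite mulrDr mulr1; lra.
Qed.

Lemma sum_powR_le q n K : 0 < q -> (0 < n)%N ->
  q * \sum_(n.+1 <= j < K) j%:R `^ (- (1 + q)) <= n%:R `^ (- q) :> R.
Proof.
move=> q0 n0; case: (leqP n.+1 K) => [nK|Kn]; last first.
  by rewrite big_geq ?mulr0 ?powR_ge0 // ltnW.
case: K nK => // K nK; rewrite big_add1 /=.
apply: (@le_trans _ _ (n%:R `^ (- q) - K%:R `^ (- q))); last first.
  by rewrite gerBl powR_ge0.
rewrite big_distrr /= -opprB.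
rewrite -(telescope_sumr (fun j => j%:R `^ (- q) : R)) // -sumrN.
rewrite !big_nat; apply: ler_sum => j /andP[nj _].
have j0 : 0 < j%:R :> R by rewrite ltr0n (leq_trans n0).
have j1 : 0 < j.+1%:R :> R by rewrite ltr0n.
have := @powR_ge_tangent_neg (- q) j.+1%:R j%:R.
rewrite oppr_le0 (ltW q0) j0 j1 => /(_ isT isT isT).
have -> : j.+1%:R `^ (- (1 + q)) = j.+1%:R `^ (- q) / j.+1%:R :> R.
  rewrite opprD addrC powRD; last by rewrite (gt_eqF j1) implybT.
  by rewrite powR_inv1 // ltW.
have -> : j%:R / j.+1%:R - 1 = - j.+1%:R^-1 :> R.
  by rewrite -{1}(addrK 1 j%:R) natr1 mulrBl divff ?gt_eqF // mul1r; ring.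
move: (_^-1) (_ `^ _) (j%:R `^ _) => u v z; lra.
Qed.

End PowerEstimates.

(** * Weighted perimeters *)

Section WeightedPerimeter.
Variable R : realType.
Implicit Types (c d w h s : R).

(** The symmetric sum avoids distinguishing the longer side from the shorter one,
    unlike min(w, h)^d max(w, h), which it equals up to a factor 2 if d <= 1. *)
Definition wperim d w h : R := w `^ d * h + w * h `^ d.

Lemma wperim_le d w h w' h' : 0 <= d -> 0 <= w <= w' -> 0 <= h <= h' ->
  wperim d w h <= wperim d w' h'.
Proof.
move=> d0 /andP[w0 ww] /andP[h0 hh].
by rewrite lerD // ler_pM ?powR_ge0 // ge0_ler_powR ?nnegrE //;
  [exact: le_trans ww | exact: le_trans hh].
Qed.

Lemma powR1D d s : 0 < s -> s `^ (1 + d) = s * s `^ d.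
Proof.
by move=> s0; rewrite powRD ?(gt_eqF s0) ?implybT // powRr1 ?ltW.
Qed.

Lemma wperim_square d s : 0 < s -> wperim d s s = 2 * s `^ (1 + d).
Proof. by move=> s0; rewrite /wperim powR1D //; ring. Qed.

Lemma wperim_gap d s r : 0 < d <= 1 -> 0 < s -> 0 <= r <= 1 ->
  wperim d s (s * r) <= 2 * (s `^ (1 + d) * r `^ d).
Proof.
move=> /andP[d0 d1] s0 /andP[r0 r1].
rewrite /wperim powRM ?(ltW s0) // powR1D //.
have rd : r <= r `^ d.
  move: r0; rewrite le_eqVlt => /predU1P[<-|r0]; first exact: powR_ge0.
  by rewrite ger1_powR // r0.
have sd : 0 <= s * s `^ d by rewrite mulr_ge0 ?powR_ge0 ?ltW.
have := ler_wpM2l sd rd; lra.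
Qed.

(** The area is w^(1-d) times one of the two terms of the weighted perimeter and
    h^(1-d) times the other one, so a large quotient of the area by the weighted
    perimeter makes both sides large. *)
Lemma wperim_fat d c w h : 0 <= w -> 0 <= h -> 0 <= c ->
  c * wperim d w h < w * h -> c < w `^ (1 - d) /\ c < h `^ (1 - d).
Proof.
move=> w0 h0 c0 cf.
have split_pow (x : R) : 0 <= x -> x `^ (1 - d) * x `^ d = x.
  by move=> x0; rewrite -powRD ?subrK ?powRr1 // oner_eq0.
split; rewrite ltNge; apply/negP => le_c; move: cf; apply/negP; rewrite -leNgt.
- apply: (@le_trans _ _ (c * (w `^ d * h))); last first.
    by rewrite ler_wpM2l // lerDl mulr_ge0 // powR_ge0.
  by rewrite -{1}(split_pow w w0) -mulrA ler_wpM2r // mulr_ge0 // powR_ge0.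
- apply: (@le_trans _ _ (c * (w * h `^ d))); last first.
    by rewrite ler_wpM2l // lerDr mulr_ge0 // powR_ge0.
  by rewrite -{1}(split_pow h h0) mulrCA ler_wpM2r // mulr_ge0 // powR_ge0.
Qed.

End WeightedPerimeter.

(** * Length and cost of a row *)

Section RowEstimates.
Variable R : realType.
Variable t : R.
Hypothesis t0 : 0 < t.
Hypothesis t1 : t < 1.

Let d := 1 - t.
Let k := d ^+ 2.

Definition side (n : nat) : R := n%:R `^ (- t).

Definition row_width (n m : nat) : R := \sum_(i <- iota n m) side i.

Lemma side_ge0 n : 0 <= side n. Proof. exact: powR_ge0. Qed.

Lemma side_gt0 n : (0 < n)%N -> 0 < side n.
Proof. by move=> n0; rewrite powR_gt0 // ltr0n. Qed.

Lemma side_le n i : (0 < n)%N -> (n <= i)%N -> side i <= side n.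
Proof.
move=> n0 ni; rewrite /side !powRN lef_pV2 ?posrE ?powR_gt0 ?ltr0n //;
  last exact: leq_trans ni.
by apply: ge0_ler_powR; rewrite ?nnegrE ?ler0n ?ler_nat ?(ltW t0).
Qed.

(** A crude lower bound on a side in terms of an earlier one: the index at most
    doubles along a row, and 2^t <= 2. *)
Lemma side_double n i : (0 < n)%N -> (i <= n.*2)%N -> (0 < i)%N ->
  side n / 2 <= side i.
Proof.
move=> n0 i2 i0; rewrite /side !powRN -invfM lef_pV2 ?posrE; last 2 first.
- by rewrite mulr_gt0 // powR_gt0 // ltr0n.
- by rewrite powR_gt0 // ltr0n.
apply: (@le_trans _ _ ((n%:R * 2) `^ t)).
  apply: ge0_ler_powR; rewrite ?nnegrE ?ler0n ?(ltW t0) ?mulr_ge0 //.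
  by rewrite -natrM ler_nat muln2.
rewrite powRM // ler_wpM2l ?powR_ge0 //.
by rewrite ler1_powR ?ler1n // ltW.
Qed.

(** The tangent inequality gives this bound with an extra factor t < 1. *)
Lemma side_gap n i : (0 < n)%N -> (n <= i)%N ->
  side n - side i <= side n * ((i - n)%:R / n%:R).
Proof.
move=> n0 ni; have N0 : 0 < n%:R :> R by rewrite ltr0n.
have I0 : 0 < i%:R :> R by rewrite ltr0n (leq_trans n0).
have := @powR_ge_tangent_neg R (- t) _ _ _ N0 I0.
rewrite oppr_le0 (ltW t0) -/(side n) -/(side i) => /(_ isT).
have -> : i%:R / n%:R - 1 = (i - n)%:R / n%:R :> R.
  by rewrite natrB // mulrBl divff // gt_eqF.
have : 0 <= side n * ((i - n)%:R / n%:R).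
  by rewrite mulr_ge0 ?side_ge0 // divr_ge0.
have t1' : 0 <= 1 - t by rewrite subr_ge0 ltW.
move: (_ / _) => u su0.
have := mulr_ge0 t1' su0; move: (side n) (side i) => x y; lra.
Qed.

Lemma row_widthS n m : row_width n m.+1 = row_width n m + side (n + m).
Proof. by rewrite /row_width -addn1 iotaD big_cat /= big_seq1. Qed.

Lemma sum_iota_const n m (c : R) : m%:R * c = \sum_(i <- iota n m) c.
Proof. by rewrite big_const_seq count_predT size_iota iter_addr addr0 mulr_natl. Qed.

Lemma row_width_ge n m : (0 < n)%N -> (m <= n)%N ->
  m%:R * (side n / 2) <= row_width n m.
Proof.
move=> n0 mn; rewrite (sum_iota_const n).
rewrite /row_width !big_seq; apply: ler_sum => i; rewrite mem_iota => /andP[ni im].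
by apply: side_double => //; lia.
Qed.

Lemma row_width_le n m : (0 < n)%N -> row_width n m <= m%:R * side n.
Proof.
move=> n0; rewrite (sum_iota_const n).
rewrite /row_width !big_seq; apply: ler_sum => i; rewrite mem_iota => /andP[ni im].
exact: side_le.
Qed.

(** The row is taken as long as possible, which bounds the gap at its end by one
    side. It is at most 1 long while n squares would be longer than that, since
    n^(1-t) > 2: hence m <= n, all sides in the row are comparable to the first
    one, and m = O(n^t). *)
Lemma row_length n M w : (0 < n)%N -> 2 < n%:R `^ d ->
    w <= 1 -> M%:R * side n < w ->
  exists m, [/\ (M <= m)%N, (m <= n)%N, row_width n m <= w,
    w <= row_width n m + side n & m%:R <= 2 * n%:R `^ t].
Proof.
move=> n0 large w1 Mw.
have sn0 := side_gt0 n0.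
have w0 : 0 <= w by apply: le_trans (ltW Mw); rewrite mulr_ge0 ?side_ge0.
have N0 : 0 < n%:R :> R by rewrite ltr0n.
have Nd : n%:R `^ d = n%:R * side n.
  by rewrite /d /side powRD ?powRr1 // (gt_eqF N0) implybT.
have wn : w < row_width n n.+1.
  rewrite row_widthS; apply: le_lt_trans w1 _.
  have := row_width_ge n0 (leqnn n); have := side_ge0 (n + n).
  move: large; rewrite Nd; lra.
have exm : exists m, (w < row_width n m.+1)%R by exists n.
case: (ex_minnP exm) => m wm min_m.
have mn : (m <= n)%N by exact: min_m.
have mw : row_width n m <= w.
  case: m {wm mn} min_m => [|m] min_m; first by rewrite /row_width big_nil.
  by rewrite leNgt; apply/negP => /min_m; rewrite ltnn.
exists m; split => //.
- rewrite leqNgt; apply/negP => mM; move: wm; apply/negP; rewrite -leNgt.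
  apply: le_trans (row_width_le _ n0) _; apply: le_trans (ltW Mw).
  by rewrite ler_wpM2r ?side_ge0 // ler_nat.
- move: wm; rewrite row_widthS => /ltW/le_trans; apply.
  by rewrite lerD2l side_le // leq_addr.
- have Nt : n%:R `^ t * side n = 1.
    by rewrite /side -powRD ?subrr ?powRr0 // (gt_eqF N0) implybT.
  rewrite -(ler_pM2r sn0) -mulrA Nt mulr1.
  have := row_width_ge n0 mn; lra.
Qed.

(** The cost of a square of side n^-t is, up to a constant, the derivative of
    n^k, because -t (1 + d) = k - 1 for d = 1 - t and k = d^2. *)
Lemma powR_side n : (0 < n)%N -> side n `^ (1 + d) = n%:R `^ k / n%:R.
Proof.
move=> n0; have N0 : 0 < n%:R :> R by rewrite ltr0n.
rewrite /side -powRrM -[in RHS]powR_inv1 ?ltW // -powRD ?(gt_eqF N0) ?implybT //.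
by congr powR; rewrite /k /d; ring.
Qed.

(** The left-hand side bounds the cost of the gap at the end of the row, then of
    the gaps above the m squares. With S = n^(k-1), the right-hand side is at
    least M^-t k m S / 2; half of it pays for the first gap because m >= M and M^d
    is large, the other half for the gaps above because (m/n)^d = O(n^-k). *)
Lemma row_cost n m M : (0 < M)%N -> (0 < n)%N ->
    8 / k <= M%:R `^ d -> 16 * M%:R `^ t / k <= n%:R `^ k ->
    (M <= m)%N -> (m <= n)%N -> m%:R <= 2 * n%:R `^ t ->
  2 * side n `^ (1 + d) +
      m%:R * (2 * (side n `^ (1 + d) * (m%:R / n%:R) `^ d)) <=
    M%:R `^ (- t) * ((n + m)%:R `^ k - n%:R `^ k).
Proof.
move=> M0 n0 Md nk Mm mn mt.
have d0 : 0 < d by rewrite subr_gt0.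
have k0 : 0 < k by rewrite exprn_gt0.
have N0 : 0 < n%:R :> R by rewrite ltr0n.
have MR0 : 0 < M%:R :> R by rewrite ltr0n.
have S0 : 0 < side n `^ (1 + d) by rewrite powR_gt0 // side_gt0.
set S := side n `^ (1 + d) in S0 *.
set e := M%:R `^ (- t).
have e0 : 0 < e by rewrite powR_gt0.
have growth : k * (S * m%:R / 2) <= (n + m)%:R `^ k - n%:R `^ k.
  have NM0 : 0 < (n + m)%:R :> R by rewrite ltr0n addn_gt0 n0.
  have := powR_ge_growth (ltW k0) N0 NM0.
  have -> : 1 - n%:R / (n + m)%:R = m%:R / (n + m)%:R :> R.
    by rewrite natrD; field; rewrite -natrD gt_eqF.
  have : S * m%:R / 2 <= n%:R `^ k * (m%:R / (n + m)%:R).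
    rewrite /S powR_side // -!mulrA ler_wpM2l ?powR_ge0 // mulrCA.
    rewrite ler_wpM2l // -invfM lef_pV2 ?posrE // ?mulr_gt0 //.
    have mnR : m%:R <= n%:R :> R by rewrite ler_nat.
    rewrite natrD; lra.
  move/(ler_wpM2l (ltW k0)); rewrite mulrDr mulr1 mulrCA; lra.
have em : 8 <= e * k * m%:R.
  have eM : e * M%:R = M%:R `^ d.
    rewrite /e -[X in _ * X]powRr1 ?ltW // -powRD; last first.
      by rewrite (gt_eqF MR0) implybT.
    by rewrite addrC.
  have : 8 <= k * (e * M%:R) by rewrite eM mulrC -ler_pdivrMr.
  have : e * k * M%:R <= e * k * m%:R.
    have ek0 : 0 <= e * k by apply: mulr_ge0; exact: ltW.
    by rewrite ler_wpM2l // ler_nat.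
  lra.
have er : (m%:R / n%:R) `^ d <= e * k / 8.
  have step1 : m%:R / n%:R <= 2 * n%:R `^ (- d) :> R.
    rewrite ler_pdivrMr // -mulrA; suff -> : n%:R `^ (- d) * n%:R = n%:R `^ t :> R by [].
    rewrite -[X in _ * X]powRr1 ?ltW // -powRD; last first.
      by rewrite (gt_eqF N0) implybT.
    by congr powR; rewrite /d; ring.
  apply: (@le_trans _ _ ((2 * n%:R `^ (- d)) `^ d)).
    by apply: ge0_ler_powR; rewrite ?nnegrE ?(ltW d0) ?divr_ge0 ?mulr_ge0 ?powR_ge0.
  rewrite powRM ?powR_ge0 // -powRrM.
  have -> : - d * d = - k by rewrite /k; ring.
  rewrite powRN /e powRN.
  have P0 : 0 < M%:R `^ t :> R by rewrite powR_gt0.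
  have Q0 : 0 < n%:R `^ k :> R by rewrite powR_gt0.
  have step2 : 2 `^ d <= 2 :> R by rewrite ler1_powR ?ler1n // /d gerBl ltW.
  apply: (@le_trans _ _ (2 / n%:R `^ k)); first by rewrite ler_wpM2r // invr_ge0 ltW.
  rewrite ler_pdivrMr // mulrAC -mulrA.
  (* [nk] multiplied by M^-t k / 8 *)
  have -> : (2 : R) = (M%:R `^ t)^-1 * (k / 8 * (16 * M%:R `^ t / k)).
    by field; rewrite !gt_eqF.
  rewrite -[leRHS]mulrA; apply: ler_wpM2l; first by rewrite invr_ge0 ltW.
  have := ler_wpM2l (ltW k0) nk.
  move: (16 * _ / k) (n%:R `^ k) => x y; lra.
have := ler_wpM2l (ltW e0) growth.
have mS0 : 0 <= S * m%:R by rewrite mulr_ge0 // ltW.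
have := ler_wpM2l mS0 er; have := ler_wpM2l (ltW S0) em.
move: (_ `^ _ - _) (_ `^ d) => x y; lra.
Qed.

End RowEstimates.

(** * Packing one row *)

Section PackingStep.
Variable R : realType.
Implicit Types (B C : box R) (F G Q S : seq (box R)).

Definition cost (d : R) B := wperim d (bwidth B) (bheight B).

(** Averaging over the boxes. *)
Lemma fat_box_exists (d c : R) F :
    c * (\sum_(C <- F) cost d C) < \sum_(C <- F) area C ->
  exists2 C, C \in F & c * cost d C < area C.
Proof.
move=> lt_sum; apply/hasP; apply: contraT => /hasPn noC.
move: lt_sum; rewrite ltNge big_distrr /= !big_seq ler_sum // => C CF.
by rewrite leNgt noC.
Qed.

Variable t : R.
Hypothesis t0 : 0 < t.
Hypothesis t1 : t < 1.

Let d := 1 - t.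
Let k := d ^+ 2.

(** The new list of boxes consists of the gaps of the row, of what remains of the
    cut box above the row, which costs no more than the cut box itself, and of
    the other boxes. The conclusion on dissections is stated for all [Q] since
    the squares placed earlier are left untouched. *)
Lemma row_step n M F : (0 < M)%N -> (0 < n)%N ->
    8 / k <= M%:R `^ d -> 16 * M%:R `^ t / k <= n%:R `^ k ->
    all (fun C => [&& 0 <= bwidth C, bwidth C <= 1 & 0 <= bheight C]) F ->
    n%:R `^ (- (2 * t - 1)) < \sum_(C <- F) area C ->
    \sum_(C <- F) cost d C <= M%:R `^ (- t) * n%:R `^ k ->
  exists m S F', [/\ (0 < m)%N,
    map (@dims R) S = [seq (side t i, side t i) | i <- iota n m],
    \sum_(C <- F') cost d C <= M%:R `^ (- t) * (n + m)%:R `^ k &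
    forall B Q, dissects B (Q ++ F) -> dissects B ((Q ++ S) ++ F')].
Proof.
move=> M0 n0 Md nk dimF areaF costF.
have d0 : 0 < d by rewrite subr_gt0.
have k0 : 0 < k by rewrite exprn_gt0.
have N0 : 0 < n%:R :> R by rewrite ltr0n.
have MR0 : 0 < M%:R :> R by rewrite ltr0n.
set s := side t n; have s0 : 0 < s by exact: side_gt0.
have large : 2 < n%:R `^ d.
  have k1 : k <= 1 by rewrite exprn_ile1 ?(ltW d0) // /d gerBl ltW.
  have M1 : 1 <= M%:R `^ t :> R 
    by rewrite -[leLHS](powRr0 M%:R) ler_powR ?ler1n // ltW.
  have : n%:R `^ k <= n%:R `^ d :> R.
    apply: ler_powR; first by rewrite ler1n.
    by rewrite /k expr2 ger_pMr // /d gerBl ltW.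
  have : 16 <= 16 * M%:R `^ t / k.
    by rewrite ler_pdivlMr // ler_wpM2l // (le_trans k1).
  move: nk; lra.
(* On average, the quotient of the area by the cost exceeds the value that it has
   at squares of side M s, up to the constant in [wperim_square]. *)
pose c := (M%:R * s) `^ t.
have [|C CF Cfat] := @fat_box_exists d c F.
  apply: le_lt_trans areaF.
  apply: (@le_trans _ _ (c * (M%:R `^ (- t) * n%:R `^ k))).
    by rewrite ler_wpM2l ?powR_ge0.
  rewrite /c /s /side powRM ?powR_ge0 ?(ltW MR0) //.
  rewrite mulrA [_ * _ * M%:R `^ _]mulrAC -powRD ?(gt_eqF MR0) ?implybT //.
  rewrite subrr powRr0 mul1r -powRrM -powRD ?(gt_eqF N0) ?implybT //.
  by rewrite le_eqVlt; apply/orP; left; apply/eqP; congr powR; rewrite /k /d; ring.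
have /and3P[w0 w1 h0] := allP dimF _ CF.
have := perm_to_rem CF.
case: C CF Cfat w0 w1 h0 => [[[x y] w] h] CF.
rewrite /cost /area /bwidth /bheight /= => Cfat w0 w1 h0.
set F0 := rem _ _ => perF.
have [] := wperim_fat w0 h0 (powR_ge0 _ _) Cfat.
have -> : 1 - d = t by rewrite /d; ring.
have lt_pow z : 0 <= z -> c < z `^ t -> M%:R * s < z.
  move=> z0; rewrite !ltNge; apply: contra => zM.
  by apply: ge0_ler_powR; rewrite ?nnegrE ?(ltW t0) ?mulr_ge0 ?(ltW s0).
move=> /(lt_pow _ w0) Mw /(lt_pow _ h0) Mh.
have sM : s <= M%:R * s by rewrite ler_peMl ?(ltW s0) // ler1n.
have [m [Mm mn rw rw' mt]] := row_length t0 t1 n0 large w1 Mw.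
have sh : 0 <= s <= h by rewrite (ltW s0) (le_trans sM) // ltW.
have [||S [G [dSG dimS dimG]]] :=
  @dissects_row R x y w s [seq side t i | i <- iota n m] (ltW s0).
- apply/allP => a /mapP[i]; rewrite mem_iota => /andP[ni _] ->.
  by rewrite side_ge0 side_le.
- by rewrite big_map.
have dcut := dissects_hcut x y w0 sh.
exists m, S, (G ++ (x, y + s, w, h - s) :: F0); split.
- exact: leq_trans Mm.
- by rewrite dimS -map_comp.
- apply: (@le_trans _ _ (M%:R `^ (- t) * n%:R `^ k +
      M%:R `^ (- t) * ((n + m)%:R `^ k - n%:R `^ k))); last first.
    by rewrite mulrBr addrC subrK.
  apply: le_trans (lerD costF (row_cost t0 t1 M0 n0 Md nk Mm mn mt)).
  have costG : \sum_(C <- G) cost d C <= 2 * s `^ (1 + d) +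
      m%:R * (2 * (s `^ (1 + d) * (m%:R / n%:R) `^ d)).
    have -> : \sum_(C <- G) cost d C =
        \sum_(p <- map (@dims R) G) wperim d p.1 p.2 by rewrite big_map.
    rewrite dimG big_cons /= -map_comp !big_map.
    rewrite -wperim_square //; apply: lerD.
      apply: wperim_le; rewrite ?(ltW d0) ?lexx ?(ltW s0) //.
      by rewrite -/(row_width t n m) subr_ge0 rw lerBlDl.
    rewrite (sum_iota_const n) !big_seq; apply: ler_sum => i.
    rewrite mem_iota => /andP[ni im] /=.
    have rm : 0 <= (m%:R / n%:R : R) <= 1.
      by rewrite divr_ge0 //= ler_pdivrMr // mul1r ler_nat.
    apply: le_trans (wperim_gap _ s0 rm); last first.
      by rewrite d0 /d gerBl ltW.
    apply: wperim_le; rewrite ?(ltW d0) ?side_ge0 ?side_le ?subr_ge0 ?side_le //=.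
    apply: le_trans (side_gap t0 t1 n0 ni) _.
    rewrite ler_wpM2l ?(ltW s0) // ler_wpM2r ?invr_ge0 ?ler0n // ler_nat.
    by rewrite leq_subLR ltnW.
  have top : cost d (x, y + s, w, h - s) <= cost d (x, y, w, h).
    by apply: wperim_le; rewrite /= ?(ltW d0) ?w0 ?lexx //; lra.
  have -> : \sum_(C <- F) cost d C =
      cost d (x, y, w, h) + \sum_(C <- F0) cost d C.
    by rewrite (perm_big _ perF) big_cons.
  have -> : \sum_(C <- G ++ (x, y + s, w, h - s) :: F0) cost d C =
      \sum_(C <- G) cost d C + (cost d (x, y + s, w, h - s) +
        \sum_(C <- F0) cost d C) by rewrite big_cat big_cons.
  rewrite -/d -/s addrA [leRHS]addrAC lerD2r addrC; exact: lerD.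
- move=> B Q dQF.
  have {}dQF : dissects B ((x, y, w, h) :: (Q ++ F0)).
    apply: dissects_perm dQF.
    by rewrite -cat1s perm_sym perm_catCA perm_cat2l perm_sym.
  have := dissects_refine (dissects_refine dQF dcut) dSG.
  apply: dissects_perm; apply/permP => p.
  by rewrite !count_cat /= !count_cat; ring.
Qed.

End PackingStep.

(** * Iterating the step *)

(** The states of a process are pairs of a list which only grows at its end and of
    auxiliary data. The lists have a limit, each prefix of which is a prefix of
    the list of some reachable state. *)
Lemma growing_seq_limit (T X : Type) (x0 : T) (inv : seq T * X -> Prop)
    (st0 : seq T * X) :
    inv st0 ->
    (forall st, inv st -> exists st' S,
      [/\ inv st', (0 < size S)%N & st'.1 = st.1 ++ S]) ->
  exists P : nat -> T,
    forall m, exists st S, inv st /\ st.1 = mkseq P m ++ S.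
Proof.
move=> inv0 step.
pose next st st' := inv st -> inv st' /\
  exists2 S, (0 < size S)%N & st'.1 = st.1 ++ S.
have [f fP] : {f & forall st, next st (f st)}.
  apply: choice => st; have [/step[st' [S [? ? ?]]]|ninv] := pselect (inv st).
    by exists st' => _; split => //; exists S.
  by exists st.
pose st_ m := iter m f st0.
have inv_ m : inv (st_ m) by elim: m => // m /fP[].
have grow i m : exists S, (st_ (m + i)%N).1 = (st_ i).1 ++ S.
  elim: m => [|m [S eqS]]; first by exists [::]; rewrite cats0.
  have [_ [S' _ eqS']] := fP _ (inv_ (m + i)%N).
  by exists (S ++ S'); rewrite addSn [st_ _]/= eqS' eqS catA.
have size_ m : (m <= size (st_ m).1)%N.
  elim: m => // m IH; have [_ [S S0 eqS]] := fP _ (inv_ m).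
  by rewrite [st_ _]/= eqS size_cat; apply: (leq_ltn_trans IH); lia.
exists (fun i => nth x0 (st_ i.+1).1 i) => m.
exists (st_ m), (drop m (st_ m).1); split => //.
rewrite -[LHS](cat_take_drop m); congr (_ ++ _).
apply: (@eq_from_nth _ x0) => [|i]; rewrite size_takel // ?size_mkseq // => im.
rewrite nth_take // nth_mkseq //.
have [S] := grow i.+1 (m - i.+1)%N; rewrite subnK // => ->.
by rewrite nth_cat size_.
Qed.

Section Iteration.
Variable R : realType.
Variable t : R.
Hypothesis t0 : 0 < t.
Hypothesis t1 : t < 1.

Let d := 1 - t.
Let k := d ^+ 2.

(** The invariant is that the placed squares and the free boxes dissect [B], with a
    bounded cost for the free boxes. Their total area then is the area of [B]
    minus the areas of the placed squares, which [row_step] needs to be large. *)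
Lemma exists_apart_squares n0 M (B : box R) : (0 < M)%N -> (0 < n0)%N ->
    8 / k <= M%:R `^ d ->
    (forall n, (n0 <= n)%N -> 16 * M%:R `^ t / k <= n%:R `^ k) ->
    0 <= bwidth B <= 1 -> 0 <= bheight B ->
    cost d B <= M%:R `^ (- t) * n0%:R `^ k ->
    (forall n, (n0 <= n)%N -> n%:R `^ (- (2 * t - 1)) <
      area B - \sum_(n0 <= i < n) side t i ^+ 2) ->
  exists P : nat -> box R,
    [/\ forall i, (n0 <= i)%N -> dims (P i) = (side t i, side t i),
        forall i, (n0 <= i)%N -> encloses B (P i) &
        forall i j, (n0 <= i)%N -> (i < j)%N -> apart (P i) (P j)].
Proof.
move=> M0 n00 Md nk /andP[w0 w1] h0 costB tail.
pose placed (Q : seq (box R)) :=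
  map (@dims R) Q = [seq (side t i, side t i) | i <- iota n0 (size Q)].
pose inv (st : seq (box R) * seq (box R)) := [/\ placed st.1,
  \sum_(C <- st.2) cost d C <= M%:R `^ (- t) * (n0 + size st.1)%:R `^ k
  & dissects B (st.1 ++ st.2)].
have inv0 : inv ([::], [:: B]).
  by split; rewrite /= ?addn0 ?big_seq1 //; exact: dissects_self.
have [|P HP] := @growing_seq_limit _ _ B inv _ inv0.
  move=> [Q F] [/= plQ costF dQF].
  set n := (n0 + size Q)%N in costF.
  have n0n : (n0 <= n)%N by exact: leq_addr.
  have dimF : all (fun C => [&& 0 <= bwidth C, bwidth C <= 1 & 0 <= bheight C]) F.
    have [inQF _ _] := dQF; move: inQF; rewrite all_cat => /andP[_].
    apply: sub_all => C /and5P[wC hC ? ? _].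
    by rewrite wC hC /= andbT; lra.
  have areaF : n%:R `^ (- (2 * t - 1)) < \sum_(C <- F) area C.
    have [_ _] := dQF; rewrite big_cat /=.
    have -> : \sum_(C <- Q) area C = \sum_(n0 <= i < n) side t i ^+ 2.
      have -> : \sum_(C <- Q) area C = \sum_(p <- map (@dims R) Q) p.1 * p.2.
        by rewrite big_map.
      rewrite plQ big_map /index_iota /n addKn.
      by apply: eq_bigr => i _; rewrite expr2.
    have := tail n n0n; lra.
  have [m [S [F' [m0 dimS costF' dis]]]] :=
    row_step t0 t1 M0 (leq_trans n00 n0n) Md (nk n n0n) dimF areaF costF.
  have sizeS : size S = m.
    by have /(congr1 size) := dimS; rewrite !size_map size_iota.
  exists (Q ++ S, F'), S; split => //; last by rewrite sizeS.
  split => /=.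
  - by rewrite /placed map_cat plQ dimS size_cat sizeS iotaD map_cat.
  - by rewrite size_cat sizeS addnA.
  - exact: dis.
(* The k-th placed square is the one of index n0 + k. *)
pose P' i := P (i - n0)%N.
have prefix m : exists S F, inv (mkseq P m ++ S, F).
  have [[Q F] [S [invQ /= eqQ]]] := HP m.
  by exists S, F; rewrite -eqQ.
have nth_i i m S : (i < m)%N -> nth B (mkseq P m ++ S) i = P i.
  by move=> im; rewrite nth_cat size_mkseq im nth_mkseq.
exists P'; split.
- move=> i ni; have [S [F [plQ _ _]]] := prefix (i - n0).+1.
  have sz : (i - n0 < size (mkseq P (i - n0).+1 ++ S))%N.
    by rewrite size_cat size_mkseq addSn ltnS leq_addr.
  rewrite /P' -(nth_i (i - n0)%N (i - n0).+1 S) // -(nth_map _ (0, 0)) //.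
  rewrite plQ (nth_map 0%N) ?size_iota // nth_iota //.
  by rewrite subnKC.
- move=> i ni; have [S [F [_ _ [inB _ _]]]] := prefix (i - n0).+1.
  rewrite /P' -(nth_i (i - n0)%N (i - n0).+1 S) //.
  move: inB; rewrite all_cat => /andP[/all_nthP inB _].
  by apply: inB; rewrite size_cat size_mkseq addSn ltnS leq_addr.
- move=> i j ni ij; have [S [F [_ _ [_ sepB _]]]] := prefix (j - n0).+1.
  rewrite /P' -(nth_i (i - n0)%N (j - n0).+1 S); last first.
    by rewrite ltnS leq_sub2r // ltnW.
  rewrite -(nth_i (j - n0)%N (j - n0).+1 S) //.
  move: sepB; rewrite pairwise_cat => /and3P[_ /(pairwiseP B) sepB _].
  apply: sepB; rewrite ?inE ?size_cat ?size_mkseq ?addSn ?ltnS ?leq_addr //.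
    by rewrite (leq_trans _ (leq_addr _ _)) // leq_sub2r // ltnW.
  by rewrite ltn_sub2r // (leq_ltn_trans ni).
Qed.

End Iteration.

(** * From boxes to planar sets *)

Section PlanarSets.
Variable R : realType.
Implicit Types (B C : box R).

Definition closed_box B : set (R * R) :=
  `[bleft B, bleft B + bwidth B] `*` `[bbottom B, bbottom B + bheight B].

Definition open_box B : set (R * R) :=
  `]bleft B, bleft B + bwidth B[ `*` `]bbottom B, bbottom B + bheight B[.

(** Slicing a neighbourhood of a point along both axes reduces the claim to the
    interior of an interval. *)
Lemma interior_closed_box B : (closed_box B)° `<=` open_box B.
Proof.
move=> [x y] /= [[U V] /= [Ux Vy] UV].
split => /=.
- have : (`[bleft B, bleft B + bwidth B]%classic : set R)° x.
    apply: filterS Ux => x' Ux'.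
    by have [] := UV (x', y) (conj Ux' (nbhs_singleton Vy)).
  by rewrite interior_itv.
- have : (`[bbottom B, bbottom B + bheight B]%classic : set R)° y.
    apply: filterS Vy => y' Vy'.
    by have [] := UV (x, y') (conj (nbhs_singleton Ux) Vy').
  by rewrite interior_itv.
Qed.

Lemma open_box_sub B : open_box B `<=` closed_box B.
Proof.
move=> [x y] [/= + +]; rewrite /= !in_itv /= => /andP[? ?] /andP[? ?].
by split; rewrite /= in_itv /=; apply/andP; split; exact: ltW.
Qed.

Lemma apart_open_box B C : apart B C -> open_box B `&` open_box C = set0.
Proof.
move=> sBC; apply/seteqP; split => // -[x y] [[/= + +] [/= + +]].
rewrite /= !in_itv /= => /andP[? ?] /andP[? ?] /andP[? ?] /andP[? ?].
by case/or4P: sBC => ?; lra.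
Qed.

Lemma encloses_closed_box B C :
  encloses B C -> closed_box C `<=` closed_box B.
Proof.
case/and5P => ? ? ? ? /andP[? ?] [x y] [/= + +].
rewrite /= !in_itv /= => /andP[? ?] /andP[? ?].
by split; rewrite /= in_itv /=; apply/andP; split; lra.
Qed.

Lemma measurable_open_box B : measurable (open_box B).
Proof. by apply: measurableX; exact: measurable_itv. Qed.

Lemma measurable_closed_box B : measurable (closed_box B).
Proof. by apply: measurableX; exact: measurable_itv. Qed.

Lemma lebesgue2_itvX (x y w h : R) (b1 b2 b3 b4 : bool) : 0 < w -> 0 < h ->
  lebesgue2 ([set` Interval (BSide b1 x) (BSide b2 (x + w))] `*`
    [set` Interval (BSide b3 y) (BSide b4 (y + h))]) = (w * h)%:E.
Proof.
move=> w0 h0; rewrite /lebesgue2.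
transitivity (lebesgue_measure [set` Interval (BSide b1 x) (BSide b2 (x + w)%R)] *
    lebesgue_measure [set` Interval (BSide b3 y) (BSide b4 (y + h)%R)])%E.
  by apply: product_measure1E; exact: measurable_itv.
rewrite !lebesgue_measure_itv /= !lte_fin !ltrDl w0 h0.
by rewrite -!EFinB -EFinM [x + _]addrC [y + _]addrC !addrK.
Qed.

(** The open boxes are pairwise disjoint, so their union has measure the sum of the
    areas, which is the measure of [B]; the complement of this smaller union
    already is a null set. *)
Lemma perfect_packing_of_boxes (n0 : nat) (s : nat -> R) (P : nat -> box R) B :
    0 < bwidth B -> 0 < bheight B ->
    (forall i, (n0 <= i)%N -> 0 < s i) ->
    (forall i, (n0 <= i)%N -> dims (P i) = (s i, s i)) ->
    (forall i, (n0 <= i)%N -> encloses B (P i)) ->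
    (forall i j, (n0 <= i)%N -> (i < j)%N -> apart (P i) (P j)) ->
    (area B)%:E = (\sum_(n0 <= i <oo) (s i ^+ 2)%:E)%E ->
  can_perfectly_pack [set n : nat | (n0 <= n)%N] s (closed_box B).
Proof.
move=> w0 h0 s0 dimP inP sepP areaB.
have wP i : (n0 <= i)%N -> bwidth (P i) = s i by move=> /dimP[].
have hP i : (n0 <= i)%N -> bheight (P i) = s i by move=> /dimP[].
have disj i j : (n0 <= i)%N -> (n0 <= j)%N -> i != j ->
    open_box (P i) `&` open_box (P j) = set0.
  move=> ni nj; rewrite neq_ltn => /orP[ij|ji].
    exact/apart_open_box/sepP.
  by rewrite setIC; exact/apart_open_box/sepP.
exists (closed_box \o P); split => [i ni /=|].
  split; first exact: s0.
  by exists (bleft (P i)), (bbottom (P i)); rewrite /closed_box wP // hP.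
split; first split.
- exact: countableP.
- move=> i /= ni; exists (bleft (P i)), (bleft (P i) + s i),
    (bbottom (P i)), (bbottom (P i) + s i).
  by rewrite /closed_box wP // hP // !ltrDl s0.
- by move=> i /= /inP; exact: encloses_closed_box.
- move=> i j /= ni nj [p [/interior_closed_box pi /interior_closed_box pj]].
  apply/eqP; apply: contraT => /(disj _ _ ni nj) ij0.
  by have : (open_box (P i) `&` open_box (P j)) p by []; rewrite ij0.
pose U := \bigcup_i open_box (P (i + n0)%N).
have mU : measurable U by apply: bigcup_measurable => i _; exact: measurable_open_box.
have UB : U `<=` closed_box B.
  move=> p [i _ /open_box_sub]; apply: encloses_closed_box.
  by apply: inP; rewrite leq_addl.
have muU : lebesgue2 U = (area B)%:E.
  rewrite /lebesgue2 measure_bigcup; last 2 first.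
  - by move=> i _; exact: measurable_open_box.
  - apply/trivIsetP => i j _ _ ij; apply: disj; rewrite ?leq_addl //.
    by rewrite eqn_add2r.
  rewrite areaB -nneseries_addn; last by move=> i; rewrite lee_fin sqr_ge0.
  rewrite (eq_eseriesl (Q := xpredT)); last by move=> i; rewrite in_setT.
  apply: eq_eseriesr => i _.
  transitivity (lebesgue2 (open_box (P (i + n0)%N))); first by [].
  have ni : (n0 <= i + n0)%N by rewrite leq_addl.
  by rewrite /open_box lebesgue2_itvX ?wP ?hP ?s0.
have muB : lebesgue2 (closed_box B) = (area B)%:E.
  by rewrite /closed_box lebesgue2_itvX.
exists (closed_box B `\` U); split.
- by apply: measurableD => //; exact: measurable_closed_box.
- transitivity (lebesgue2 (closed_box B) - lebesgue2 (closed_box B `&` U))%E.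
    apply: measureD => //; first exact: measurable_closed_box.
    by change (lebesgue2 (closed_box B) < +oo)%E; rewrite muB ltry.
  by rewrite setIidr // muU muB -EFinB subrr.
- apply: setDS => p [i _ /open_box_sub pi].
  by exists (i + n0)%N => //=; rewrite leq_addl.
Qed.

End PlanarSets.

(** * The total area of the squares *)

Section TotalArea.
Variable R : realType.
Variable t : R.

Lemma sqr_side n : 1 / 2 < t -> side t n ^+ 2 = n%:R `^ (- (1 + (2 * t - 1))).
Proof.
move=> t2.
rewrite /side expr2 -powRD; first by congr powR; ring.
have tt : 0 < t + t by lra.
by rewrite -opprD oppr_eq0 gt_eqF.
Qed.

Lemma side_series_le1 n0 K : 1 / 2 < t -> (1 < n0)%N ->
    (2 * t - 1)^-1 <= n0.-1%:R `^ (2 * t - 1) ->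
  \sum_(n0 <= i < K) side t i ^+ 2 <= 1.
Proof.
move=> t2 n01 large; have q0 : 0 < 2 * t - 1 by lra.
have p0 : (0 < n0.-1)%N by lia.
have := @sum_powR_le R _ n0.-1 K q0 p0; rewrite prednK ?(ltnW n01) //.
have -> : \sum_(n0 <= j < K) j%:R `^ (- (1 + (2 * t - 1))) =
    \sum_(n0 <= j < K) side t j ^+ 2.
  by apply: eq_bigr => j _; rewrite sqr_side.
have P0 : 0 < n0.-1%:R `^ (2 * t - 1) :> R by rewrite powR_gt0 // ltr0n.
move=> le_sum; rewrite -(ler_pM2l q0) mulr1; apply: le_trans le_sum _.
by rewrite powRN -[leRHS]invrK lef_pV2 ?posrE // invr_gt0.
Qed.

(** The tail of the series is at least n^-q / q with q = 2 t - 1 < 1; the factor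
    1 / q > 1 makes the inequality strict and absorbs the truncation at K. *)
Lemma side_series_tail_gt n A : 1 / 2 < t -> t < 1 -> (0 < n)%N ->
    (forall K, \sum_(n <= i < K) side t i ^+ 2 <= A) ->
  n%:R `^ (- (2 * t - 1)) < A.
Proof.
move=> t2 t1 n0 boundA; set q := 2 * t - 1.
have q0 : 0 < q by rewrite /q; lra.
have q1 : q < 1 by rewrite /q; lra.
set x := n%:R `^ (- q).
have x0 : 0 < x by rewrite powR_gt0 // ltr0n.
have e0 : 0 < x * (1 - q) by rewrite mulr_gt0 // subr_gt0.
have [K0 HK] := powR_nat_unbounded (2 / (x * (1 - q))) q0.
have nK : (n <= n + K0)%N by rewrite leq_addr.
have := sum_powR_ge q0 n0 nK.
have -> : \sum_(n <= j < n + K0) j%:R `^ (- (1 + q)) =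
    \sum_(n <= j < n + K0) side t j ^+ 2.
  by apply: eq_bigr => j _; rewrite sqr_side.
have small : (n + K0)%:R `^ (- q) <= x * (1 - q) / 2.
  rewrite powRN -[leRHS]invf_div lef_pV2 ?posrE ?divr_gt0 //.
    exact/HK/leq_addl.
  by rewrite powR_gt0 // ltr0n addn_gt0 n0.
have := ler_wpM2l (ltW q0) (boundA (n + K0)%N).
rewrite -(ltr_pM2l q0) -/x; move: small e0; lra.
Qed.

End TotalArea.

Theorem theorem1p1 (R : realType) (t : R) (ht1 : 1 / 2 < t) (ht2 : t < 1) :
  exists N : nat, forall n0 : nat, (N <= n0)%N ->
    exists (L : R) (Omega : set (R * R)),
      [/\ is_square L Omega,
          lebesgue2 Omega = (\sum_(n0 <= n <oo) (1 / n%:R `^ (2 * t))%:E)%E &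
          can_perfectly_pack [set n : nat | (n0 <= n)%N]
            (fun n : nat => n%:R `^ (- t)) Omega].
Proof.
have t0 : 0 < t by lra.
pose d := 1 - t; have d0 : 0 < d by rewrite subr_gt0.
pose k := d ^+ 2; have k0 : 0 < k by rewrite exprn_gt0.
(* M makes the gaps at the ends of the rows cheap; after N1, the gaps above the
   squares are cheap and the initial cost is allowed; after N2, the side of the
   big square is at most 1. *)
have [M0 HM] := powR_nat_unbounded (8 / k) d0.
pose M := M0.+1; have Md : 8 / k <= M%:R `^ d by apply: HM; rewrite leqnSn.
have [N1 HN1] := powR_nat_unbounded (16 * M%:R `^ t / k) k0.
have q0 : 0 < 2 * t - 1 by lra.
have [N2 HN2] := powR_nat_unbounded (2 * t - 1)^-1 q0.
exists (N1 + N2).+2 => n0 Nn0.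
have n01 : (1 < n0)%N by lia.
have n00 : (0 < n0)%N by lia.
have N1n0 : (N1 <= n0)%N by lia.
have N2n0 : (N2 <= n0.-1)%N by lia.
have sE n : 1 / n%:R `^ (2 * t) = side t n ^+ 2.
  by rewrite sqr_side // div1r -powRN; congr powR; ring.
have bound K : \sum_(n0 <= i < K) side t i ^+ 2 <= 1.
  by apply: side_series_le1 => //; exact: HN2.
set T := (\sum_(n0 <= n <oo) _)%E.
have u0 n : (n0 <= n)%N -> true -> (0 <= (1 / n%:R `^ (2 * t))%:E :> \bar R)%E.
  by move=> _ _; rewrite lee_fin sE sqr_ge0.
have sumE K : (\sum_(n0 <= i < K) (1 / i%:R `^ (2 * t))%:E)%E =
    (\sum_(n0 <= i < K) side t i ^+ 2)%:E.
  by rewrite sumEFin; congr EFin; apply: eq_bigr => i _; rewrite sE.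
have T1 : (T <= 1)%E.
  apply: lime_le; first exact: is_cvg_nneseries.
  by near=> K; rewrite sumE lee_fin.
have Tfin : T \is a fin_num.
  rewrite ge0_fin_numE; first exact: le_lt_trans T1 (ltry _).
  exact: nneseries_ge0.
pose A := fine T; have TA : T = A%:E by rewrite /A fineK.
have A1 : A <= 1 by rewrite -lee_fin -TA.
have sumA K : \sum_(n0 <= i < K) side t i ^+ 2 <= A.
  by rewrite -lee_fin -TA -sumE; exact: nneseries_lim_ge.
have tail n : (n0 <= n)%N -> n%:R `^ (- (2 * t - 1)) <
    A - \sum_(n0 <= i < n) side t i ^+ 2.
  move=> n0n; apply: side_series_tail_gt => // [|K]; first exact: leq_trans n0n.
  rewrite lerBrDl; have [nK|Kn] := leqP n K.
    by rewrite -big_cat_nat.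
  by rewrite [X in _ + X]big_geq ?addr0 // ltnW.
have A0 : 0 < A.
  have := tail n0 (leqnn _); rewrite big_geq // subr0; apply: le_lt_trans.
  exact: powR_ge0.
pose L := Num.sqrt A.
have L0 : 0 < L by rewrite sqrtr_gt0.
have L1 : L <= 1 by rewrite -sqrtr1 ler_wsqrtr.
have LA : L * L = A by rewrite -expr2 sqr_sqrtr // ltW.
pose B : box R := (0, 0, L, L).
have costB : cost d B <= M%:R `^ (- t) * n0%:R `^ k.
  rewrite /cost [bwidth _]/= [bheight _]/= wperim_square //.
  have Ld : L `^ (1 + d) <= 1.
    apply: (@le_trans _ _ (1 `^ (1 + d))); last by rewrite powR1.
    have d10 : 0 <= 1 + d by apply: addr_ge0 => //; exact: ltW.
    by apply: ge0_ler_powR; rewrite ?nnegrE ?(ltW L0).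
  have k1 : k <= 1 by rewrite exprn_ile1 ?(ltW d0) // /d gerBl ltW.
  have P0 : 0 < M%:R `^ t :> R by rewrite powR_gt0.
  have le_k : 16 * M%:R `^ t / k <= n0%:R `^ k by exact: HN1.
  apply: (@le_trans _ _ 2); first lra.
  rewrite powRN mulrC ler_pdivlMr //; apply: le_trans le_k.
  rewrite ler_pdivlMr //; have := ler_wpM2l (ltW P0) k1; lra.
have large n : (n0 <= n)%N -> 16 * M%:R `^ t / k <= n%:R `^ k.
  by move=> n0n; apply: HN1; exact: leq_trans n0n.
have w1 : 0 <= bwidth B <= 1 by rewrite /bwidth /= (ltW L0).
have areaB : area B = A by rewrite /area /= LA.
have tailB n : (n0 <= n)%N -> n%:R `^ (- (2 * t - 1)) <
    area B - \sum_(n0 <= i < n) side t i ^+ 2 by rewrite areaB; exact: tail.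
have [P [dimP inP apartP]] :=
  exists_apart_squares t0 ht2 (isT : (0 < M)%N) n00 Md large w1 (ltW L0) costB
    tailB.
exists L, (closed_box B); split.
- by split => //; exists 0, 0.
- by rewrite TA -LA /closed_box lebesgue2_itvX.
- apply: (perfect_packing_of_boxes (P := P)) => //.
  + by move=> i ni; apply: side_gt0; exact: leq_trans ni.
  + by rewrite areaB -TA; apply: eq_eseriesr => i _; rewrite sE.
Unshelve. all: by end_near. Qed.
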